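(* Let $A=\{a_k\}_{k\in\mathbb{Z}}$ and $B=\{b_k\}_{k\in\mathbb{Z}}$ be sequences of complex numbers, each being $o(k^{c})$ as $k\to\pm\infty$ for some $c<1$. Let $k>1$ be an integer and let $\alpha,\beta$ be nonzero real numbers. Then $$\begin{aligned} &\alpha^{2k-1}\beta\pi\sum_{n=1}^\infty\frac{a_n\coth\left(\frac{n\beta\pi}{\alpha};B\right)}{n^{2k-1}}+(-1)^k\beta^{2k-1}\alpha\pi\sum_{n=1}^\infty\frac{b_n\coth\left(\frac{n\alpha\pi}{\beta};A\right)}{n^{2k-1}}\\ &=b_0\alpha^{2k}D^{(A)}(2k)+(-1)^ka_0\beta^{2k}D^{(B)}(2k)-2\sum_{\substack{j_1+j_2=k\\ j_1,j_2\ge1}}(-1)^{j_2}\alpha^{2j_1}\beta^{2j_2}D^{(A)}(2j_1)D^{(B)}(2j_2). \end{aligned}$$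
   Context: Growth conditions $a_k=o(k^c)$ are understood with $|k|^c$ for negative $k$. For a sequence $A=\{a_k\}$ (likewise $B=\{b_k\}$): $D^{(A)}(j):=\sum_{k=1}^\infty\frac{a_k}{k^j}$ for $j>1$. The cotangent function with sequence $A$ is defined by $$\pi\cot(\pi s;A):=\frac{a_0}{s}-2s\sum_{k=1}^\infty\frac{a_k}{k^2-s^2},$$ and the hyperbolic cotangent with sequence $A$ by $\coth(s;A):=i\cot(is;A)$. *)

(* Defs.v *)
From Stdlib Require Import Reals ZArith.
From Coquelicot Require Import Coquelicot.

Local Open Scope C_scope.

(* Sum of a complex series, obtained from [is_series] exactly as [RInt] is
   obtained from [is_RInt]; it is unspecified when the series diverges. *)
Definition CSeries (u : nat -> C) : C :=
  @iota C_CompleteNormedModule (@is_series C_AbsRing C_NormedModule u).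

Lemma CSeries_unique (u : nat -> C) (l : C) :
  @is_series C_AbsRing C_NormedModule u l -> CSeries u = l.
Proof.
exact (@iota_filterlim_locally _ C_CompleteNormedModule _ eventually _ (sum_n u) l).
Qed.

(* Series indexed from 1, as all those below. *)
Definition sum1 (u : nat -> C) : C := CSeries (fun n => u (S n)).
Definition ex_sum1 (u : nat -> C) : Prop :=
  @ex_series C_AbsRing C_NormedModule (fun n => u (S n)).

(* a_k = o(|k|^c) as k -> +oo and as k -> -oo; [is_domin F f g] is g = o_F(f). *)
Definition growth_o (c : R) (A : Z -> C) : Prop :=
  @is_domin nat R_AbsRing C_AbsRing R_NormedModule C_NormedModule eventually
    (fun n => Rpower (INR n) c) (fun n => A (Z.of_nat n)) /\
  @is_domin nat R_AbsRing C_AbsRing R_NormedModule C_NormedModule eventually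
    (fun n => Rpower (INR n) c) (fun n => A (- Z.of_nat n)%Z).

Definition Dser (A : Z -> C) (j : nat) : C :=
  sum1 (fun k => A (Z.of_nat k) / RtoC (INR k) ^ j).

(* s |-> pi cot(pi s; A) *)
Definition pi_cot_pi (A : Z -> C) (s : C) : C :=
  A 0%Z / s
  - 2 * s * sum1 (fun k => A (Z.of_nat k) / (RtoC (INR k) ^ 2 - s ^ 2)).

Definition cot_seq (z : C) (A : Z -> C) : C := pi_cot_pi A (z / PI) / PI.

Definition coth_seq (s : C) (A : Z -> C) : C := Ci * cot_seq (Ci * s) A.

(* Main.v *)
Require Import Defs.
From Stdlib Require Import Reals ZArith Lra Lia.
From Coquelicot Require Import Coquelicot.

(** Expanding coth at the points in question gives
    [pi coth(n beta pi / alpha; B)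
       = b_0 alpha / (n beta) + 2 n alpha beta sum_m b_m / (m^2 alpha^2 + n^2 beta^2)].
    The [b_0] and [a_0] parts are the two D-terms; what remains are two double
    series over (n, m).  The growth condition only enters through the absolute
    convergence of [sum a_n / n^2] and [sum b_m / m^2], which dominates both double
    series, so each equals the limit of its partial sums over the squares
    [n, m <= N].  With [u = alpha^2 / n^2] and [v = beta^2 / m^2] the two summands
    add up to a multiple of
    [(u^k v + (-1)^k v^k u) / (u + v) = - sum_(0 < j < k) (-1)^(k-j) u^j v^(k-j)],
    a finite sum of products, whose square sums tend to products of D-values. *)

(** * Convergence of p-series with real exponents, and absolute summability from the growth
    condition *)

Local Open Scope R_scope.

(** By the mean value theorem the difference on the right, divided by [d], is [xi^(-d-1)] for some
    [xi] in [[x, x+1]], and this power decreases in [xi]. *)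
Lemma Rpower_le_telescope (d x : R) :
  0 < d -> 0 < x ->
  Rpower (x + 1) (- d - 1) <= (Rpower x (- d) - Rpower (x + 1) (- d)) / d.
Proof.
intros Hd Hx.
assert (Hder : forall y, 0 < y ->
  is_derive (fun t => Rpower t (- d)) y (- d * Rpower y (- d - 1))).
{ intros y Hy. now apply is_derive_Reals, derivable_pt_lim_power. }
destruct (MVT_gen (fun t => Rpower t (- d)) x (x + 1)
            (fun t => - d * Rpower t (- d - 1))) as [xi [Hxi Heq]];
  rewrite ?Rmin_left, ?Rmax_right in * by lra.
- intros y Hy. apply Hder. lra.
- intros y Hy. apply derivable_continuous_pt.
  eexists. apply derivable_pt_lim_power. lra.
- assert (Hle : Rpower (x + 1) (- d - 1) <= Rpower xi (- d - 1)).
  { replace (- d - 1) with (- (d + 1)) by ring. rewrite !Rpower_Ropp.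
    apply Rinv_le_contravar; [apply exp_pos | apply Rle_Rpower_l; lra]. }
  apply Rmult_le_reg_r with d; [exact Hd|].
  unfold Rdiv. rewrite Rmult_assoc, Rinv_l by lra. nra.
Qed.

Lemma ex_series_Rpower (p : R) :
  1 < p -> ex_series (fun n => Rpower (INR (S n)) (- p)).
Proof.
intros Hp. set (d := p - 1). assert (Hd : 0 < d) by (unfold d; lra).
(* The term at 1 is split off: the telescoping bound at [x + 1] requires [x > 0], so it starts with
   the term at 2. *)
apply (ex_series_incr_1 (fun n => Rpower (INR (S n)) (- p))).
set (a := fun n => Rpower (INR (S (S n))) (- p)).
assert (Hpos : forall n, 0 < a n) by (intro; apply exp_pos).
assert (Hsum : forall n,
  sum_n a n <= (Rpower 1 (- d) - Rpower (INR (S (S n))) (- d)) / d).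
{ assert (Hstep : forall n, a n <=
    (Rpower (INR (S n)) (- d) - Rpower (INR (S (S n))) (- d)) / d).
  { intro n. unfold a. rewrite (S_INR (S n)).
    replace (- p) with (- d - 1) by (unfold d; ring).
    apply Rpower_le_telescope; [exact Hd | apply lt_0_INR; lia]. }
  induction n as [|n IH].
  - rewrite sum_O. apply (Hstep 0%nat).
  - rewrite sum_Sn.
    specialize (Hstep (S n)). unfold Rdiv in *.
    change (sum_n a n + a (S n) <=
      (Rpower 1 (- d) - Rpower (INR (S (S (S n)))) (- d)) * / d). lra. }
destruct (ex_finite_lim_seq_incr (sum_n a) (Rpower 1 (- d) / d)) as [l Hl].
- intro n. rewrite sum_Sn. specialize (Hpos (S n)).
  change (sum_n a n <= sum_n a n + a (S n)). lra.
- intro n. eapply Rle_trans; [apply Hsum|].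
  apply Rmult_le_compat_r; [left; now apply Rinv_0_lt_compat|].
  assert (0 < Rpower (INR (S (S n))) (- d)) by apply exp_pos. lra.
- now exists l.
Qed.

(** From some rank on [|a_n| <= n^c], so the terms are at most [n^(-(2-c))], and [2 - c > 1]. *)
Lemma ex_series_growth (c : R) (A : Z -> C) :
  c < 1 -> growth_o c A ->
  ex_series (fun n => Cmod (A (Z.of_nat (S n))) / INR (S n) ^ 2).
Proof.
intros Hc [HA _].
(* Any fixed epsilon in the little-o would do; 1 keeps the majorant free of constants. *)
destruct (HA (mkposreal 1 Rlt_0_1)) as [N HN].
apply (ex_series_incr_n _ N).
apply (@ex_series_le R_AbsRing R_CompleteNormedModule) with
  (fun n => Rpower (INR (S (N + n))) (- (2 - c))).
- intro n. specialize (HN (S (N + n)) ltac:(lia)). simpl in HN.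
  set (x := INR (S (N + n))) in *.
  assert (Hx : 0 < x) by (apply lt_0_INR; lia).
  change (Cmod (A (Z.of_nat (S (N + n)))) <= 1 * Rabs (Rpower x c)) in HN.
  change (Rabs (Cmod (A (Z.of_nat (S (N + n)))) / x ^ 2) <= Rpower x (- (2 - c))).
  rewrite Rabs_right in HN by (left; apply exp_pos).
  assert (Hx2 : 0 < x ^ 2) by now apply pow_lt.
  rewrite Rabs_right.
  + replace (- (2 - c)) with (c + - INR 2) by (simpl; ring).
    rewrite Rpower_plus, Rpower_Ropp, Rpower_pow by exact Hx.
    apply Rmult_le_compat_r; [left; now apply Rinv_0_lt_compat | lra].
  + apply Rle_ge, Rdiv_le_0_compat; [apply Cmod_ge_0 | exact Hx2].
- apply (ex_series_incr_n (fun n => Rpower (INR (S n)) (- (2 - c))) N).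
  apply ex_series_Rpower. lra.
Qed.

(** * Double series as limits of sums over squares *)

Lemma minus_plus_cancel {G : AbelianGroup} (x y : G) : plus (minus x y) y = x.
Proof.
unfold minus. now rewrite <- plus_assoc, (plus_opp_l (G := G)), plus_zero_r.
Qed.

Lemma minus_minus {G : AbelianGroup} (x y : G) : minus x (minus x y) = y.
Proof.
apply (plus_reg_r (G := G) (minus x y)).
transitivity x; [apply minus_plus_cancel|].
rewrite plus_comm. symmetry. apply minus_plus_cancel.
Qed.

Lemma sum_n_minus {G : AbelianGroup} (f g : nat -> G) (N : nat) :
  sum_n (fun n => minus (f n) (g n)) N = minus (sum_n f N) (sum_n g N).
Proof.
apply (plus_reg_r (G := G) (sum_n g N)).
transitivity (sum_n f N); [|symmetry; apply minus_plus_cancel].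
rewrite <- sum_n_plus. apply sum_n_ext. intro n. apply minus_plus_cancel.
Qed.

Section DoubleSeries.
Context {K : AbsRing} {V : NormedModule K}.

Lemma norm_series_le (a : nat -> V) (b : nat -> R) (l : V) (lb : R) :
  (forall n, norm (a n) <= b n) -> is_series a l -> is_series b lb ->
  norm l <= lb.
Proof.
intros Hab Ha Hb.
change (Rbar_le (norm l) lb).
apply (@filterlim_le nat eventually _ (fun N => norm (sum_n a N)) (sum_n b)).
- exists 0%nat. intros N _. eapply Rle_trans; [apply (norm_sum_n_m (V := V) _ 0 N)|].
  now apply sum_n_m_le.
- apply (filterlim_comp _ _ _ _ _ _ _ _ Ha), filterlim_norm.
- exact Hb.
Qed.

(** The remainder after rank [N] is itself the sum of a shifted series, to which the comparison of
    sums applies. *)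
Lemma norm_series_tail_le (a : nat -> V) (b : nat -> R) (l : V) (lb : R) :
  (forall n, norm (a n) <= b n) -> is_series a l -> is_series b lb ->
  forall N, norm (minus l (sum_n a N)) <= lb - sum_n b N.
Proof.
intros Hab Ha Hb N.
apply norm_series_le with (fun k => a (S N + k)%nat) (fun k => b (S N + k)%nat).
- intro k. apply Hab.
- apply is_series_incr_n; [lia|]. simpl Nat.pred. unfold minus.
  now rewrite <- plus_assoc, (plus_opp_l (G := V)), plus_zero_r.
- apply (is_series_incr_n b); [lia|]. simpl Nat.pred.
  change (is_series b (lb - sum_n b N + sum_n b N)).
  now replace (lb - sum_n b N + sum_n b N) with lb by ring.
Qed.

(** Squares treat both indices alike, so exchanging the order of summation reduces to exchanging two
    finite sums, and linearity is inherited from finite sums. *)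
Definition is_square_series (f : nat -> nat -> V) (l : V) : Prop :=
  filterlim (fun N => sum_n (fun n => sum_n (f n) N) N) eventually (locally l).

(** The partial sum of the row sums exceeds the square sum by the row tails beyond [N]. The tail of
    row [n] is at most [u n * (sv - sum_n v N)], so the total error is at most
    [sum_n u N * (sv - sum_n v N)], which tends to 0. *)
Lemma is_series_dominated_square (f : nat -> nat -> V) (u v : nat -> R)
    (r : nat -> V) (l : V) :
  (forall n m, norm (f n m) <= u n * v m) -> ex_series u -> ex_series v ->
  (forall n, is_series (f n) (r n)) -> is_series r l -> is_square_series f l.
Proof.
intros Hf [su Hsu] [sv Hsv] Hr Hl.
assert (Huv : forall n, is_series (fun m => u n * v m) (u n * sv)).
{ intro n. exact (is_series_scal (u n) v sv Hsv). }
set (sq := fun N => sum_n (fun n => sum_n (f n) N) N : V).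
set (err := fun N => minus (sum_n r N) (sq N) : V).
assert (Herr : filterlim err eventually (locally (zero : V))).
{ apply filterlim_norm_zero.
  apply (is_lim_seq_le_le (fun _ => 0) (fun N => norm (err N))
           (fun N => sum_n u N * (sv - sum_n v N)) 0).
  - intro N. split; [apply norm_ge_0|].
    assert (Heq : err N = sum_n (fun n => minus (r n) (sum_n (f n) N)) N).
    { symmetry. exact (sum_n_minus (G := V) r (fun n => sum_n (f n) N) N). }
    rewrite Heq. eapply Rle_trans; [apply (norm_sum_n_m (V := V) _ 0 N)|].
    rewrite <- (sum_n_mult_r (K := R_Ring) (sv - sum_n v N)).
    apply sum_n_m_le. intro n.
    replace (mult (u n) (sv - sum_n v N))
      with (u n * sv - sum_n (fun m => u n * v m) N).
    + apply norm_series_tail_le; auto.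
    + rewrite (sum_n_mult_l (K := R_Ring) (u n)).
      change (u n * sv - u n * sum_n v N = u n * (sv - sum_n v N)). ring.
  - apply is_lim_seq_const.
  (* The limit 0 is written as the product of the limits of the two factors. *)
  - replace (Finite 0) with (Rbar_mult su (sv - sv)) by (simpl; f_equal; ring).
    apply is_lim_seq_mult'; [exact Hsu|].
    apply is_lim_seq_minus'; [apply is_lim_seq_const | exact Hsv]. }
unfold is_square_series.
apply filterlim_ext with (fun N => minus (sum_n r N) (err N)).
{ intro N. unfold err. apply minus_minus. }
replace l with (minus l zero) by apply minus_zero_r.
eapply (filterlim_comp_2 (sum_n r) (fun N => opp (err N)) plus).
- exact Hl.
- apply (filterlim_comp _ _ _ _ _ _ _ _ Herr), filterlim_opp.
- apply filterlim_plus.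
Qed.

Lemma is_square_series_unique (f : nat -> nat -> V) (l1 l2 : V) :
  is_square_series f l1 -> is_square_series f l2 -> l1 = l2.
Proof. apply filterlim_locally_unique. Qed.

Lemma is_square_series_ext (f g : nat -> nat -> V) (l : V) :
  (forall n m, f n m = g n m) -> is_square_series f l -> is_square_series g l.
Proof.
intros H. apply filterlim_ext. intro N.
apply sum_n_ext. intro n. now apply sum_n_ext.
Qed.

Lemma is_square_series_swap (f : nat -> nat -> V) (l : V) :
  is_square_series f l -> is_square_series (fun n m => f m n) l.
Proof.
apply filterlim_ext. intro N. apply sum_n_switch.
Qed.

Lemma is_square_series_plus (f g : nat -> nat -> V) (lf lg : V) :
  is_square_series f lf -> is_square_series g lg ->
  is_square_series (fun n m => plus (f n m) (g n m)) (plus lf lg).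
Proof.
intros Hf Hg.
eapply filterlim_ext;
  [| eapply (filterlim_comp_2 _ _ plus);
       [exact Hf | exact Hg | apply filterlim_plus]].
intro N. symmetry. etransitivity;
  [| exact (sum_n_plus (G := V) (fun n => sum_n (f n) N) (fun n => sum_n (g n) N) N)].
apply sum_n_ext. intro n. exact (sum_n_plus (f n) (g n) N).
Qed.

Lemma is_square_series_scal (c : K) (f : nat -> nat -> V) (l : V) :
  is_square_series f l ->
  is_square_series (fun n m => scal c (f n m)) (scal c l).
Proof.
intros Hf.
eapply filterlim_ext;
  [| exact (filterlim_comp _ _ _ _ _ _ _ _ Hf (filterlim_scal_r c l))].
intro N. symmetry. etransitivity;
  [| exact (sum_n_scal_l c (fun n => sum_n (f n) N) N)].
apply sum_n_ext. intro n. exact (sum_n_scal_l c (f n) N).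
Qed.

Lemma is_square_series_sum (F : nat -> nat -> nat -> V) (L : nat -> V)
    (p q : nat) :
  (forall j, (p <= j <= q)%nat -> is_square_series (F j) (L j)) ->
  is_square_series (fun n m => sum_n_m (fun j => F j n m) p q) (sum_n_m L p q).
Proof.
assert (Hzero : is_square_series (fun _ _ => zero) zero).
{ apply filterlim_ext with (fun _ => zero); [|apply filterlim_const].
  intro N. symmetry.
  transitivity (sum_n (fun _ => zero : V) N); [|apply sum_n_m_const_zero].
  apply sum_n_ext. intro n. apply sum_n_m_const_zero. }
induction q as [|q IH]; intros HF.
- destruct p as [|p].
  + rewrite sum_n_n.
    apply is_square_series_ext with (F 0%nat); [|apply HF; lia].
    intros n m. now rewrite sum_n_n.
  + rewrite sum_n_m_zero by lia.
    apply is_square_series_ext with (fun _ _ => zero); [|exact Hzero].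
    intros n m. now rewrite sum_n_m_zero by lia.
- destruct (Nat.le_gt_cases p (S q)) as [Hp|Hp].
  + rewrite sum_n_Sm by exact Hp.
    eapply is_square_series_ext;
      [| apply is_square_series_plus; [apply IH | apply (HF (S q)); lia]].
    * intros n m. now rewrite sum_n_Sm.
    * intros j Hj. apply HF. lia.
  + rewrite sum_n_m_zero by lia.
    apply is_square_series_ext with (fun _ _ => zero); [|exact Hzero].
    intros n m. now rewrite sum_n_m_zero by lia.
Qed.

End DoubleSeries.

(** Row [n] has a sum of norm at most [u n] times the sum of [v], so the row sums form an absolutely
    convergent series; completeness of [V] turns this into convergence. *)
Lemma ex_series_dominated_rows {K : AbsRing} {V : CompleteNormedModule K}
    (f : nat -> nat -> V) (u v : nat -> R) (r : nat -> V) :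
  (forall n m, norm (f n m) <= u n * v m) -> ex_series u -> ex_series v ->
  (forall n, is_series (f n) (r n)) -> ex_series r.
Proof.
intros Hf Hu [sv Hsv] Hr.
apply ex_series_le with (fun n => sv * u n).
- intro n. rewrite Rmult_comm.
  apply norm_series_le with (f n) (fun m => u n * v m); auto.
  exact (is_series_scal (u n) v sv Hsv).
- exact (ex_series_scal sv u Hu).
Qed.

(** * Convergence of the D-series and of the cotangent series on the imaginary axis *)

Definition abs_summable_sq (A : Z -> C) : Prop :=
  ex_series (fun n => Cmod (A (Z.of_nat (S n))) / INR (S n) ^ 2).

Lemma INR_S_pos (n : nat) : 0 < INR (S n).
Proof. apply lt_0_INR. lia. Qed.

Local Open Scope C_scope.

Lemma RtoC_neq0 (x : R) : x <> 0%R -> RtoC x <> 0.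
Proof. intros Hx H. now apply Hx, RtoC_inj. Qed.

Lemma RtoC_INR_S_neq0 (n : nat) : RtoC (INR (S n)) <> 0.
Proof. apply RtoC_neq0, Rgt_not_eq, INR_S_pos. Qed.

Lemma Ci_sqr : Ci * Ci = - (1).
Proof. unfold Ci, Cmult, Copp, RtoC; simpl; f_equal; ring. Qed.

Lemma CSeries_correct (a : nat -> C) :
  @ex_series C_AbsRing C_NormedModule a ->
  @is_series C_AbsRing C_NormedModule a (CSeries a).
Proof. intros [l Hl]. now rewrite (CSeries_unique a l Hl). Qed.

(** Row [n] sums to [g n * H], and these row sums add up to [G * H]; the dominated case then gives
    the limit over squares. *)
Lemma is_square_series_Cmult (g h : nat -> C) (u v : nat -> R) (G H : C) :
  (forall n, Cmod (g n) <= u n)%R -> (forall m, Cmod (h m) <= v m)%R ->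
  ex_series u -> ex_series v ->
  @is_series C_AbsRing C_NormedModule g G ->
  @is_series C_AbsRing C_NormedModule h H ->
  @is_square_series C_AbsRing C_NormedModule (fun n m => g n * h m) (G * H).
Proof.
intros Hu Hv Eu Ev Hg Hh.
apply is_series_dominated_square with u v (fun n => g n * H); auto.
- intros n m. change (Cmod (g n * h m) <= u n * v m)%R. rewrite Cmod_mult.
  apply Rmult_le_compat; auto using Cmod_ge_0.
- intro n. exact (is_series_scal (V := C_NormedModule) (g n) h H Hh).
- rewrite Cmult_comm. apply is_series_ext with (fun n => H * g n).
  + intro n. apply Cmult_comm.
  + exact (is_series_scal (V := C_NormedModule) H g G Hg).
Qed.

Lemma Cmod_div_pow_le (x : C) (n j : nat) : (2 <= j)%nat ->
  (Cmod (x / RtoC (INR (S n)) ^ j) <= Cmod x / INR (S n) ^ 2)%R.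
Proof.
intros Hj. pose proof (INR_S_pos n) as Hn.
rewrite Cmod_div by apply Cpow_nz, RtoC_INR_S_neq0.
rewrite Cmod_pow, Cmod_R, Rabs_right by lra.
apply Rmult_le_compat_l; [apply Cmod_ge_0|].
apply Rinv_le_contravar; [now apply pow_lt|].
apply Rle_pow; [|exact Hj]. rewrite S_INR. pose proof (pos_INR n). lra.
Qed.

Lemma is_series_Dser (A : Z -> C) (j : nat) :
  abs_summable_sq A -> (2 <= j)%nat ->
  @is_series C_AbsRing C_NormedModule
    (fun n => A (Z.of_nat (S n)) / RtoC (INR (S n)) ^ j) (Dser A j).
Proof.
intros HA Hj. unfold Dser, sum1. apply CSeries_correct.
apply (@ex_series_le C_AbsRing C_CompleteNormedModule) with (2 := HA).
intro n. now apply Cmod_div_pow_le.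
Qed.

(** At [i y] the denominator is the real number [m^2 + y^2 >= m^2 > 0], so there are no poles and
    [|b_m| / m^2] is a majorant. *)
Lemma is_series_pi_cot_pi_imag (B : Z -> C) (y : R) :
  abs_summable_sq B ->
  @is_series C_AbsRing C_NormedModule
    (fun m => B (Z.of_nat (S m)) / (RtoC (INR (S m)) ^ 2 - (Ci * y) ^ 2))
    (sum1 (fun m => B (Z.of_nat m) / (RtoC (INR m) ^ 2 - (Ci * y) ^ 2))).
Proof.
intros HB. unfold sum1.
apply (CSeries_correct
  (fun m => B (Z.of_nat (S m)) / (RtoC (INR (S m)) ^ 2 - (Ci * y) ^ 2))).
apply (@ex_series_le C_AbsRing C_CompleteNormedModule) with (2 := HB).
intro m. pose proof (INR_S_pos m) as Hm.
assert (Hpos : (0 < INR (S m) ^ 2)%R) by now apply pow_lt.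
assert (Hy : (0 <= y ^ 2)%R) by apply pow2_ge_0.
replace (RtoC (INR (S m)) ^ 2 - (Ci * y) ^ 2)
  with (RtoC (INR (S m) ^ 2 + y ^ 2)).
- change (Cmod (B (Z.of_nat (S m)) / RtoC (INR (S m) ^ 2 + y ^ 2))
          <= Cmod (B (Z.of_nat (S m))) / INR (S m) ^ 2)%R.
  rewrite Cmod_div, Cmod_R, Rabs_right by (try (intro H; apply RtoC_inj in H); lra).
  apply Rmult_le_compat_l; [apply Cmod_ge_0|].
  apply Rinv_le_contravar; lra.
- rewrite RtoC_plus, !RtoC_pow.
  transitivity (RtoC (INR (S m)) ^ 2 - (Ci * Ci) * RtoC y ^ 2); [|ring].
  rewrite Ci_sqr. ring.
Qed.

(** * The double series behind each coth series *)

(** The exponent is [2k - 2] because the expansion of coth contributes a factor [n] that cancels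
    against [n^(2k-1)]. The weight is real so that it can be bounded by order arguments. *)
Definition lattice_weight (k : nat) (alpha beta : R) (n m : nat) : R :=
  (/ (INR (S n) ^ (2 * (k - 1)) *
      (INR (S m) ^ 2 * alpha ^ 2 + INR (S n) ^ 2 * beta ^ 2)))%R.

Definition lattice_term (A B : Z -> C) (k : nat) (alpha beta : R) (n m : nat) : C :=
  A (Z.of_nat (S n)) * B (Z.of_nat (S m)) * lattice_weight k alpha beta n m.

Lemma lattice_form_pos (alpha beta : R) (n m : nat) : alpha <> 0%R ->
  (0 < INR (S m) ^ 2 * alpha ^ 2 + INR (S n) ^ 2 * beta ^ 2)%R.
Proof.
intros Ha.
assert (0 < INR (S m) ^ 2 * alpha ^ 2)%R.
{ apply Rmult_lt_0_compat; [apply pow_lt, INR_S_pos | now apply pow2_gt_0]. }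
assert (0 <= INR (S n) ^ 2 * beta ^ 2)%R.
{ apply Rmult_le_pos; apply pow2_ge_0. }
lra.
Qed.

Lemma lattice_form_neq0 (alpha beta : R) (n m : nat) : alpha <> 0%R ->
  RtoC (INR (S m)) ^ 2 * RtoC alpha ^ 2
  + RtoC (INR (S n)) ^ 2 * RtoC beta ^ 2 <> 0.
Proof.
intros Ha. rewrite <- !RtoC_pow, <- !RtoC_mult, <- RtoC_plus.
apply RtoC_neq0, Rgt_not_eq. now apply lattice_form_pos.
Qed.

(** Dropping [n^2 beta^2] from the quadratic form and using [n^(2k-2) >= n^2], valid as [k > 1],
    decouples the two indices. *)
Lemma lattice_term_le (A B : Z -> C) (k : nat) (alpha beta : R) (n m : nat) :
  (1 < k)%nat -> alpha <> 0%R ->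
  (Cmod (lattice_term A B k alpha beta n m)
   <= Cmod (A (Z.of_nat (S n))) / INR (S n) ^ 2
      * (/ alpha ^ 2 * (Cmod (B (Z.of_nat (S m))) / INR (S m) ^ 2)))%R.
Proof.
intros Hk Ha. unfold lattice_term. rewrite !Cmod_mult, Cmod_R.
pose proof (lattice_form_pos alpha beta n m Ha) as Hq.
pose proof (INR_S_pos n) as Hn. pose proof (INR_S_pos m) as Hm.
assert (Hp := pow_lt _ (2 * (k - 1)) Hn).
assert (Hn2 := pow_lt _ 2 Hn). assert (Hm2 := pow_lt _ 2 Hm).
assert (Ha2 := pow2_gt_0 _ Ha).
rewrite Rabs_right by
  (left; apply Rinv_0_lt_compat; now apply Rmult_lt_0_compat).
replace (Cmod (A (Z.of_nat (S n))) / INR (S n) ^ 2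
      * (/ alpha ^ 2 * (Cmod (B (Z.of_nat (S m))) / INR (S m) ^ 2)))%R
  with (Cmod (A (Z.of_nat (S n))) * Cmod (B (Z.of_nat (S m)))
        * / (INR (S n) ^ 2 * (INR (S m) ^ 2 * alpha ^ 2)))%R
  by (field; lra).
apply Rmult_le_compat_l; [apply Rmult_le_pos; apply Cmod_ge_0|].
apply Rinv_le_contravar.
- apply Rmult_lt_0_compat; [|apply Rmult_lt_0_compat]; assumption.
- apply Rmult_le_compat; try nra.
  apply Rle_pow; [|lia]. rewrite S_INR. pose proof (pos_INR n). lra.
Qed.

(** Since [m^2 - (i n beta / alpha)^2 = (m^2 alpha^2 + n^2 beta^2) / alpha^2], row [n] is a constant
    multiple of the cotangent series at [i n beta / alpha]. *)
Lemma lattice_term_factor (A B : Z -> C) (k : nat) (alpha beta : R) (n m : nat) :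
  alpha <> 0%R ->
  lattice_term A B k alpha beta n m
  = A (Z.of_nat (S n)) / (RtoC (INR (S n)) ^ (2 * (k - 1)) * RtoC alpha ^ 2)
    * (B (Z.of_nat (S m)) /
       (RtoC (INR (S m)) ^ 2 - (Ci * RtoC (INR (S n) * beta / alpha)) ^ 2)).
Proof.
intros Ha. unfold lattice_term, lattice_weight.
pose proof (RtoC_neq0 alpha Ha) as Ha'.
pose proof (lattice_form_pos alpha beta n m Ha) as Hq.
pose proof (lattice_form_neq0 alpha beta n m Ha) as Hq'.
pose proof (RtoC_INR_S_neq0 n) as Hn. pose proof (RtoC_INR_S_neq0 m) as Hm.
rewrite RtoC_inv, RtoC_mult, RtoC_plus, !RtoC_mult, !RtoC_pow.
2: { apply Rmult_integral_contrapositive. split; [|lra].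
     apply pow_nonzero, Rgt_not_eq, INR_S_pos. }
replace (RtoC (INR (S n) * beta / alpha))
  with (RtoC (INR (S n)) * beta / alpha).
2: { unfold Rdiv. rewrite !RtoC_mult, RtoC_inv by exact Ha. reflexivity. }
assert (Hp : RtoC (INR (S n)) ^ (2 * (k - 1)) <> 0) by now apply Cpow_nz.
set (p := RtoC (INR (S n)) ^ (2 * (k - 1))) in *.
set (x := RtoC (INR (S n))) in *. set (y := RtoC (INR (S m))) in *.
assert (Heq : y ^ 2 - (Ci * (x * beta / alpha)) ^ 2
  = (y ^ 2 * RtoC alpha ^ 2 + x ^ 2 * RtoC beta ^ 2) / RtoC alpha ^ 2).
{ transitivity (y ^ 2 - (Ci * Ci) * (x * beta / alpha) ^ 2); [ring|].
  rewrite Ci_sqr. now field. }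
rewrite Heq. set (q := y ^ 2 * RtoC alpha ^ 2 + x ^ 2 * RtoC beta ^ 2) in *.
field. repeat split; assumption.
Qed.

(** The outer [i] of coth meets the [i] in the argument: they cancel in the [b_0] part and give
    [i^2 = -1] in the series part, turning its minus sign into a plus. *)
Lemma coth_term_eq (A B : Z -> C) (k : nat) (alpha beta : R) (n : nat) :
  (1 < k)%nat -> alpha <> 0%R -> beta <> 0%R ->
  A (Z.of_nat (S n)) * coth_seq (RtoC (INR (S n) * beta * PI / alpha)) B
    / RtoC (INR (S n)) ^ (2 * k - 1)
  = B 0%Z * alpha / (beta * PI) * (A (Z.of_nat (S n)) / RtoC (INR (S n)) ^ (2 * k))
    + 2 * alpha * beta / PI
      * (A (Z.of_nat (S n)) / (RtoC (INR (S n)) ^ (2 * (k - 1)) * RtoC alpha ^ 2)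
         * sum1 (fun m => B (Z.of_nat m) /
             (RtoC (INR m) ^ 2 - (Ci * RtoC (INR (S n) * beta / alpha)) ^ 2))).
Proof.
intros Hk Ha Hb.
assert (HP : RtoC PI <> 0).
{ apply RtoC_neq0, PI_neq0. }
assert (Ha' : RtoC alpha <> 0) by now apply RtoC_neq0.
assert (Hb' : RtoC beta <> 0) by now apply RtoC_neq0.
pose proof (RtoC_INR_S_neq0 n) as Hn.
assert (Hi : Ci <> 0) by (intro H; injection H; lra).
unfold coth_seq, cot_seq, pi_cot_pi.
replace (Ci * RtoC (INR (S n) * beta * PI / alpha) / PI)
  with (Ci * RtoC (INR (S n) * beta / alpha)).
2: { unfold Rdiv. rewrite !RtoC_mult. now field. }
set (L := sum1 _).
set (x := RtoC (INR (S n))) in *.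
replace (RtoC (INR (S n) * beta / alpha)) with (x * beta / alpha).
2: { unfold x, Rdiv. rewrite !RtoC_mult, RtoC_inv by exact Ha. reflexivity. }
(* All powers of [x] are expressed through [x^(2(k-1))], which [field] can then treat as one
   atom. *)
replace (2 * k - 1)%nat with (2 * (k - 1) + 1)%nat by lia.
replace (2 * k)%nat with (2 * (k - 1) + 2)%nat by lia.
rewrite !Cpow_add_r.
assert (Hp : x ^ (2 * (k - 1)) <> 0) by now apply Cpow_nz.
set (p := x ^ (2 * (k - 1))) in *.
(* The product [Ci * Ci] is isolated because its value is unknown to [field]. *)
transitivity (A (Z.of_nat (S n)) * ((B 0%Z / (x * beta / alpha)
    - 2 * (Ci * Ci) * (x * beta / alpha) * L) / PI) / (p * x ^ 1)).
- field. repeat split; assumption.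
- rewrite Ci_sqr. field. repeat split; assumption.
Qed.

(** The value [l] of the double series is only asserted to exist. The lemma serves twice, with the
    roles of the two sequences exchanged, and only a combination of the two values is evaluated
    later. *)
Lemma coth_series_square (A B : Z -> C) (k : nat) (alpha beta : R) :
  abs_summable_sq A -> abs_summable_sq B ->
  (1 < k)%nat -> alpha <> 0%R -> beta <> 0%R ->
  exists l : C,
    @is_square_series C_AbsRing C_NormedModule (lattice_term A B k alpha beta) l /\
    @is_series C_AbsRing C_NormedModule
      (fun n => A (Z.of_nat (S n))
         * coth_seq (RtoC (INR (S n) * beta * PI / alpha)) B
         / RtoC (INR (S n)) ^ (2 * k - 1))
      (B 0%Z * alpha / (beta * PI) * Dser A (2 * k) + 2 * alpha * beta / PI * l).
Proof.
intros HA HB Hk Ha Hb.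
set (c := fun n => A (Z.of_nat (S n)) /
            (RtoC (INR (S n)) ^ (2 * (k - 1)) * RtoC alpha ^ 2)).
set (r := fun n => c n * sum1 (fun m => B (Z.of_nat m) /
            (RtoC (INR m) ^ 2 - (Ci * RtoC (INR (S n) * beta / alpha)) ^ 2))).
set (u := fun n => (Cmod (A (Z.of_nat (S n))) / INR (S n) ^ 2)%R).
set (v := fun m => (/ alpha ^ 2 * (Cmod (B (Z.of_nat (S m))) / INR (S m) ^ 2))%R).
assert (Hdom : forall n m, (Cmod (lattice_term A B k alpha beta n m) <= u n * v m)%R).
{ intros n m. now apply lattice_term_le. }
assert (Hv : ex_series v).
{ exact (ex_series_scal (/ alpha ^ 2)%R _ HB). }
assert (Hrow : forall n,
  @is_series C_AbsRing C_NormedModule (lattice_term A B k alpha beta n) (r n)).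
{ intro n.
  apply is_series_ext with (fun m => c n * (B (Z.of_nat (S m)) /
    (RtoC (INR (S m)) ^ 2 - (Ci * RtoC (INR (S n) * beta / alpha)) ^ 2))).
  - intro m. symmetry. now apply lattice_term_factor.
  - apply (is_series_scal (V := C_NormedModule) (c n)).
    now apply is_series_pi_cot_pi_imag. }
destruct (ex_series_dominated_rows (V := C_CompleteNormedModule)
            (lattice_term A B k alpha beta) u v r Hdom HA Hv Hrow) as [l Hl].
exists l. split.
- now apply is_series_dominated_square with u v r.
- eapply is_series_ext; [intro n; symmetry; now apply coth_term_eq|].
  apply (is_series_plus (V := C_NormedModule)).
  + apply (is_series_scal (V := C_NormedModule) (B 0%Z * alpha / (beta * PI))).
    apply is_series_Dser; [exact HA | lia].
  + exact (is_series_scal (V := C_NormedModule) (2 * alpha * beta / PI) r l Hl).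
Qed.

(** * The algebraic identity that combines the two double series *)

(** With [w = -v] and [K = k + 1], the product telescopes: it is the sum of
    [u^(j+1) w^(K-j) - u^j w^(K-j+1)], of which [u^K w - u w^K] remains. *)
Lemma sum_alternating_powers (u v : C) (k : nat) :
  (u + v) * @sum_n_m C_AbelianMonoid
              (fun j => (-1) ^ (S k - j) * u ^ j * v ^ (S k - j)) 1 k
  = - (u ^ S k * v + (-1) ^ S k * v ^ S k * u).
Proof.
induction k as [|k IH].
- rewrite sum_n_m_zero by lia. change (@zero C_AbelianMonoid) with (RtoC 0). simpl. ring.
- rewrite sum_n_Sm by lia.
  (* Raising [k] by one multiplies every old summand by [-v] and appends one new summand. *)
  rewrite (sum_n_m_ext_loc _ (fun j => @mult C_Ring (- v)
    ((-1) ^ (S k - j) * u ^ j * v ^ (S k - j)))).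
  + rewrite (sum_n_m_mult_l (K := C_Ring)).
    replace (S (S k) - S k)%nat with 1%nat by lia.
    set (s := sum_n_m _ 1 k) in *.
    change ((u + v) * (- v * s + (-1) ^ 1 * u ^ S k * v ^ 1)
      = - (u ^ S (S k) * v + (-1) ^ S (S k) * v ^ S (S k) * u)).
    transitivity (- v * ((u + v) * s) + (u + v) * ((-1) ^ 1 * u ^ S k * v ^ 1)); [ring|].
    change ((u + v) * s = - (u ^ S k * v + (-1) ^ S k * v ^ S k * u)) in IH.
    rewrite IH, !Cpow_S. simpl (_ ^ 0). ring.
  + intros j Hj.
    change ((-1) ^ (S (S k) - j) * u ^ j * v ^ (S (S k) - j)
      = - v * ((-1) ^ (S k - j) * u ^ j * v ^ (S k - j))).
    replace (S (S k) - j)%nat with (S (S k - j)) by lia.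
    rewrite !Cpow_S. ring.
Qed.

(** The prefactors make the two terms equal to [a b u^k v / (u+v)] and [(-1)^k a b v^k u / (u+v)],
    so the alternating power sum applies after division by [u + v]. *)
Lemma lattice_term_symmetric_sum (A B : Z -> C) (k : nat) (alpha beta : R) (n m : nat) :
  (1 < k)%nat -> alpha <> 0%R -> beta <> 0%R ->
  RtoC alpha ^ (2 * k) * RtoC beta ^ 2 * lattice_term A B k alpha beta n m
  + (-1) ^ k * RtoC beta ^ (2 * k) * RtoC alpha ^ 2 * lattice_term B A k beta alpha m n
  = - @sum_n_m C_AbelianMonoid
        (fun j => (-1) ^ (k - j) * RtoC alpha ^ (2 * j) * RtoC beta ^ (2 * (k - j)) *
           (A (Z.of_nat (S n)) / RtoC (INR (S n)) ^ (2 * j) *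
            (B (Z.of_nat (S m)) / RtoC (INR (S m)) ^ (2 * (k - j))))) 1 (k - 1).
Proof.
intros Hk Ha Hb.
destruct k as [|k]; [lia|]. unfold lattice_term, lattice_weight.
replace (S k - 1)%nat with k by lia.
pose proof (lattice_form_pos alpha beta n m Ha) as Hq.
(* Exchanging both the parameters and the indices preserves the quadratic form up to the order of
   its summands, so the two terms share a denominator. *)
rewrite (Rplus_comm (INR (S n) ^ 2 * beta ^ 2)).
rewrite !RtoC_inv, !RtoC_mult, !RtoC_plus, !RtoC_mult, !RtoC_pow by
  (apply Rmult_integral_contrapositive; split; [|lra];
   apply pow_nonzero, Rgt_not_eq, INR_S_pos).
pose proof (lattice_form_neq0 alpha beta n m Ha) as Hq'.
pose proof (RtoC_INR_S_neq0 n) as Hx. pose proof (RtoC_INR_S_neq0 m) as Hy.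
set (x := RtoC (INR (S n))) in *. set (y := RtoC (INR (S m))) in *.
set (a := A (Z.of_nat (S n))). set (b := B (Z.of_nat (S m))).
set (al := RtoC alpha) in *. set (be := RtoC beta) in *.
assert (Hx2 : x ^ 2 <> 0) by now apply Cpow_nz.
assert (Hy2 : y ^ 2 <> 0) by now apply Cpow_nz.
set (u := al ^ 2 / x ^ 2). set (v := be ^ 2 / y ^ 2).
rewrite (sum_n_m_ext _ (fun j => @mult C_Ring (a * b)
  ((-1) ^ (S k - j) * u ^ j * v ^ (S k - j)))).
2: { intro j.
  change ((-1) ^ (S k - j) * al ^ (2 * j) * be ^ (2 * (S k - j))
      * (a / x ^ (2 * j) * (b / y ^ (2 * (S k - j))))
    = a * b * ((-1) ^ (S k - j) * u ^ j * v ^ (S k - j))).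
  unfold u, v, Cdiv.
  rewrite !Cpow_mult_l, !Cpow_inv, <- !Cpow_mult_r by assumption. ring. }
rewrite (sum_n_m_mult_l (K := C_Ring)). change (@mult C_Ring) with Cmult.
pose proof (sum_alternating_powers u v k) as Hsum.
set (s := sum_n_m _ 1 k) in *.
assert (Huv : u + v = (y ^ 2 * al ^ 2 + x ^ 2 * be ^ 2) / (x ^ 2 * y ^ 2)).
{ unfold u, v. field. now split. }
assert (Hu : forall j, u ^ j = al ^ (2 * j) / x ^ (2 * j)).
{ intro j. unfold u, Cdiv. now rewrite Cpow_mult_l, Cpow_inv, !Cpow_mult_r. }
assert (Hv : forall j, v ^ j = be ^ (2 * j) / y ^ (2 * j)).
{ intro j. unfold v, Cdiv. now rewrite Cpow_mult_l, Cpow_inv, !Cpow_mult_r. }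
(* A zero of [u + v] would be a zero of the positive form [m^2 alpha^2 + n^2 beta^2]. *)
assert (Huv0 : u + v <> 0).
{ rewrite Huv. intro H. apply Hq'.
  transitivity ((y ^ 2 * al ^ 2 + x ^ 2 * be ^ 2) / (x ^ 2 * y ^ 2)
                * (x ^ 2 * y ^ 2)).
  - field. now split.
  - rewrite H. ring. }
assert (Hs : forall t : C,
  (u + v) * t = - (u ^ S k * v + (-1) ^ S k * v ^ S k * u) ->
  t = - (u ^ S k * v + (-1) ^ S k * v ^ S k * u) / (u + v)).
{ intros t Ht. rewrite <- Ht. now field. }
rewrite (Hs s Hsum), Huv, Hu, Hv. unfold u, v.
replace (2 * S k)%nat with (2 * k + 2)%nat by lia. rewrite !Cpow_add_r.
assert (Hxk : x ^ (2 * k) <> 0) by now apply Cpow_nz.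
assert (Hyk : y ^ (2 * k) <> 0) by now apply Cpow_nz.
set (q := y ^ 2 * al ^ 2 + x ^ 2 * be ^ 2) in *. field. repeat split; assumption.
Qed.

Theorem theorem5p1 :
  forall (A B : Z -> C),
  (exists c : R, (c < 1)%R /\ growth_o c A) ->
  (exists c : R, (c < 1)%R /\ growth_o c B) ->
  forall (k : nat), (1 < k)%nat ->
  forall (alpha beta : R), alpha <> 0%R -> beta <> 0%R ->
  let termA := fun n : nat =>
    A (Z.of_nat n) * coth_seq (RtoC (INR n * beta * PI / alpha)) B
      / RtoC (INR n) ^ (2 * k - 1) in
  let termB := fun n : nat =>
    B (Z.of_nat n) * coth_seq (RtoC (INR n * alpha * PI / beta)) A
      / RtoC (INR n) ^ (2 * k - 1) in
  ex_sum1 termA /\ ex_sum1 termB /\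
  RtoC alpha ^ (2 * k - 1) * beta * PI * sum1 termA
  + (-1) ^ k * RtoC beta ^ (2 * k - 1) * alpha * PI * sum1 termB
  = B 0%Z * RtoC alpha ^ (2 * k) * Dser A (2 * k)
    + (-1) ^ k * A 0%Z * RtoC beta ^ (2 * k) * Dser B (2 * k)
    - 2 * @sum_n_m C_AbelianMonoid
            (fun j1 : nat =>
               let j2 := (k - j1)%nat in
               (-1) ^ j2 * RtoC alpha ^ (2 * j1) * RtoC beta ^ (2 * j2)
               * Dser A (2 * j1) * Dser B (2 * j2))
            1 (k - 1).
Proof.
intros A B [cA [HcA HA]] [cB [HcB HB]] k Hk alpha beta Ha Hb termA termB.
assert (SA : abs_summable_sq A) by now apply ex_series_growth with cA.
assert (SB : abs_summable_sq B) by now apply ex_series_growth with cB.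
destruct (coth_series_square A B k alpha beta) as [lA [HlA HsA]]; auto.
destruct (coth_series_square B A k beta alpha) as [lB [HlB HsB]]; auto.
split; [now eexists; apply HsA|]. split; [now eexists; apply HsB|].
assert (HtA : sum1 termA = B 0%Z * alpha / (beta * PI) * Dser A (2 * k)
                           + 2 * alpha * beta / PI * lA).
{ now apply CSeries_unique. }
assert (HtB : sum1 termB = A 0%Z * beta / (alpha * PI) * Dser B (2 * k)
                           + 2 * beta * alpha / PI * lB).
{ now apply CSeries_unique. }
set (T := @sum_n_m C_AbelianMonoid _ 1 (k - 1)).
(* Both sides are limits of the same square sums: the left by linearity, with the second double
   series transposed, the right by the termwise identity. *)
assert (Hmain : RtoC alpha ^ (2 * k) * RtoC beta ^ 2 * lA
  + (-1) ^ k * RtoC beta ^ (2 * k) * RtoC alpha ^ 2 * lB = - T).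
{ apply (is_square_series_unique (V := C_NormedModule)
    (fun n m =>
       RtoC alpha ^ (2 * k) * RtoC beta ^ 2 * lattice_term A B k alpha beta n m
       + (-1) ^ k * RtoC beta ^ (2 * k) * RtoC alpha ^ 2
         * lattice_term B A k beta alpha m n)).
  - apply (is_square_series_plus (V := C_NormedModule)).
    + now apply (is_square_series_scal (V := C_NormedModule)).
    + apply (is_square_series_scal (V := C_NormedModule)).
      now apply (is_square_series_swap (V := C_NormedModule)).
  - eapply is_square_series_ext.
    { intros n m. symmetry. now apply lattice_term_symmetric_sum. }
    replace (- T) with (- (1) * T) by ring.
    eapply is_square_series_ext;
      [| apply (is_square_series_scal (V := C_NormedModule) (- (1)));
         apply (is_square_series_sum (V := C_NormedModule)) with
         (F := fun j n m => (-1) ^ (k - j) * RtoC alpha ^ (2 * j)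
            * RtoC beta ^ (2 * (k - j))
            * (A (Z.of_nat (S n)) / RtoC (INR (S n)) ^ (2 * j)
               * (B (Z.of_nat (S m))
                  / RtoC (INR (S m)) ^ (2 * (k - j)))))].
    + intros n m. set (t := sum_n_m _ _ _). change (- (1) * t = - t). ring.
    + intros j Hj. cbv zeta.
      rewrite <- (Cmult_assoc _ (Dser A (2 * j)) (Dser B (2 * (k - j)))).
      apply (is_square_series_scal (V := C_NormedModule)
        ((-1) ^ (k - j) * RtoC alpha ^ (2 * j) * RtoC beta ^ (2 * (k - j)))).
      (* Both exponents [2j] and [2(k-j)] are at least 2 since [1 <= j <= k-1], so the two quadratic
         majorants serve every [j]. *)
      apply is_square_series_Cmult with (3 := SA) (4 := SB).
      * intro n. apply Cmod_div_pow_le. lia.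
      * intro m. apply Cmod_div_pow_le. lia.
      * apply is_series_Dser; [exact SA | lia].
      * apply is_series_Dser; [exact SB | lia]. }
rewrite HtA, HtB.
assert (Ha' := RtoC_neq0 _ Ha). assert (Hb' := RtoC_neq0 _ Hb).
assert (HP := RtoC_neq0 _ PI_neq0).
(* The outer factor [alpha^(2k-1) beta pi] times [2 alpha beta / pi] is [2 alpha^(2k) beta^2], twice
   the weight of [lA] in [Hmain]; likewise for [lB]. *)
transitivity (B 0%Z * RtoC alpha ^ (2 * k) * Dser A (2 * k)
  + (-1) ^ k * A 0%Z * RtoC beta ^ (2 * k) * Dser B (2 * k)
  + 2 * (RtoC alpha ^ (2 * k) * RtoC beta ^ 2 * lA
         + (-1) ^ k * RtoC beta ^ (2 * k) * RtoC alpha ^ 2 * lB)).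
- replace (RtoC alpha ^ (2 * k)) with (RtoC alpha ^ (2 * k - 1) * alpha).
  2: { rewrite Cmult_comm, <- Cpow_S. f_equal. lia. }
  replace (RtoC beta ^ (2 * k)) with (RtoC beta ^ (2 * k - 1) * beta).
  2: { rewrite Cmult_comm, <- Cpow_S. f_equal. lia. }
  generalize (RtoC alpha ^ (2 * k - 1)) (RtoC beta ^ (2 * k - 1)).
  intros p q. field. now repeat split.
- rewrite Hmain. ring.
Qed.
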